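(* Let $G=(V_1,E_1)$ be a connected graph with $|V_1|\ge 2$, and let $H=(V_2,E_2)$ be a $\kappa$-regular graph on $n=|V_2|\ge1$ vertices ($\kappa\ge0$) with adjacency matrix $A_H$. Put $\gamma_3=-2-\min\mathrm{ev}(A_H)$. Then $\mathrm{QEC}(G\odot H)=0$ if one of the following holds: (i) $\mathrm{QEC}(G)=0$ and $\gamma_3\le0$; (ii) $\mathrm{QEC}(G)\le0$ and $\gamma_3=0$.
   Context: All graphs are finite, simple, undirected. The corona graph $G\odot H$ is obtained by taking one copy of $G$ and $|V_1|$ disjoint copies of $H$, and joining the $i$-th vertex of $G$ to every vertex of the $i$-th copy of $H$. For a connected graph $X$ with distance matrix $D_X$, $\mathrm{QEC}(X)=\max\{\langle f,D_Xf\rangle : \langle f,f\rangle=1,\ \langle\mathbf 1,f\rangle=0\}$, $\mathbf 1$ the all-ones vector. $\mathrm{ev}(A)$ is the set of eigenvalues of $A$. *)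

(* Defs.v *)
From HB Require Import structures.
From mathcomp Require Import all_boot all_order all_algebra.
From mathcomp Require Import all_classical all_reals all_analysis.

Set Implicit Arguments.
Unset Strict Implicit.
Unset Printing Implicit Defensive.

Import Order.TTheory GRing.Theory Num.Theory.
Import numFieldNormedType.Exports.
Local Open Scope classical_set_scope.
Local Open Scope ring_scope.

Record sgraph := SGraph {
  vertex :> finType;
  adj : rel vertex;
  adj_sym : symmetric adj;
  adj_irr : irreflexive adj }.

Definition connected_graph (X : sgraph) : Prop :=
  forall x y : X, connect (@adj X) x y.

Definition regular_graph (k : nat) (X : sgraph) : Prop :=
  forall x : X, #|[set y : X | adj x y]%SET| = k.

Definition walk (X : sgraph) (k : nat) (x y : X) : bool :=
  [exists p : k.-tuple X, path (@adj X) x p && (last x p == y)].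

(* The least length of a walk from x to y; a shortest walk has no repeated
   vertex, hence length < #|X|.  The junk value #|X| is returned when x and y
   are not connected. *)
Definition dist (X : sgraph) (x y : X) : nat :=
  \big[minn/#|X|]_(k < #|X| | walk k x y) k.

Section Corona.
Variables G H : sgraph.

(* inl x is the vertex x of G; inr (x, h) is the vertex h of the copy of H
   attached to x. *)
Definition corona_adj : rel (G + G * H)%type := fun u v =>
  match u, v with
  | inl x, inl y => adj x y
  | inl x, inr (y, _) => x == y
  | inr (x, _), inl y => x == y
  | inr (x, h), inr (y, k) => (x == y) && adj h k
  end.

Lemma corona_adj_sym : symmetric corona_adj.
Proof.
case=> [x|[x h]] [y|[y k]] //=; first exact: adj_sym.
by rewrite eq_sym adj_sym.
Qed.

Lemma corona_adj_irr : irreflexive corona_adj.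
Proof. by case=> [x|[x h]] /=; rewrite adj_irr ?andbF. Qed.

Definition corona : sgraph := SGraph corona_adj_sym corona_adj_irr.

End Corona.

Section Spectral.
Variable R : realType.

(* The greatest (resp. least) element of A, and 0 if there is none; QEC_max
   and min_ev_min below show that the extrema used here exist. *)
Definition set_max (A : set R) : R := xget 0 (A `&` ubound A).
Definition set_min (A : set R) : R := xget 0 (A `&` lbound A).

Definition inner n (f g : 'cV[R]_n) : R := (f^T *m g) 0 0.

(* Rows and columns are indexed by the vertices through enum_val. *)
Definition adj_mx (X : sgraph) : 'M[R]_#|X| :=
  \matrix_(i, j) (adj (enum_val i : X) (enum_val j))%:R.

Definition dist_mx (X : sgraph) : 'M[R]_#|X| :=
  \matrix_(i, j) (dist (enum_val i : X) (enum_val j))%:R.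

Definition QEC_set (X : sgraph) : set R :=
  [set inner f (dist_mx X *m f) |
    f in [set f : 'cV[R]_#|X| | inner f f = 1 /\ inner (const_mx 1) f = 0]].

Definition QEC (X : sgraph) : R := set_max (QEC_set X).

Definition ev n (A : 'M[R]_n) : set R := [set a | eigenvalue A a].

Definition min_ev n (A : 'M[R]_n) : R := set_min (ev A).

End Spectral.

Lemma distP (X : sgraph) (x y : X) : connect (@adj X) x y ->
  (exists2 p, path (@adj X) x p & last x p = y /\ size p = dist x y) /\
  (forall p, path (@adj X) x p -> last x p = y -> (dist x y <= size p)%N).
Proof.
move=> /connectP[p0 p0P ->].
have short p : path (@adj X) x p -> exists q : seq X,
    [/\ path (@adj X) x q, last x q = last x p, (size q <= size p)%N &
        (size q < #|X|)%N].
  move=> pP; case: (shortenP pP) => q qP qU qs.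
  exists q; split=> //.
    by apply: uniq_leq_size => //; case/andP: qU.
  by have := card_uniqP qU => /= <-; exact: max_card.
have le p : path (@adj X) x p -> (dist x (last x p) <= size p)%N.
  move=> /short[q [qP <- qp qX]]; apply: leq_trans qp.
  rewrite /dist.
  have wq : walk (Ordinal qX) x (last x q).
    by apply/existsP; exists (in_tuple q); rewrite /= qP eqxx.
  have := mem_index_enum (Ordinal qX); elim: (index_enum _) => // i s ih.
  rewrite inE big_cons => /predU1P[<-|/ih{}ih]; first by rewrite wq geq_minl.
  by case: ifP => // _; apply: leq_trans ih; exact: geq_minr.
split; last by move=> p pP <-; exact: le.
have [q [qP qe _ qX]] := short _ p0P; rewrite -qe in le *.
have : (dist x (last x q) < #|X|)%N by apply: leq_ltn_trans qX; exact: le.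
rewrite /dist; elim/big_ind: _ => [|a b ha hb|k /existsP[p /andP[pP /eqP pl]] _].
- by rewrite ltnn.
- by rewrite /minn; case: ifP.
- by exists p; rewrite // size_tuple.
Qed.

Lemma corona_connected (G H : sgraph) :
  connected_graph G -> connected_graph (corona G H).
Proof.
move=> cG.
have sym : connect_sym (@adj (corona G H)).
  exact: sym_connect_sym (@adj_sym (corona G H)).
have cl (x y : G) : connect (@adj (corona G H)) (inl x) (inl y).
  have /connectP[p pP ->] := cG x y; apply/connectP.
  exists (map inl p); last by rewrite last_map.
  by rewrite path_map.
have cr (u : corona G H) (y : G) : connect (@adj (corona G H)) u (inl y).
  case: u => [x|[x h]]; first exact: cl.
  by apply: connect_trans (cl x y); apply: connect1; rewrite /= eqxx.
case=> [x|[x h]] v; first by rewrite sym.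
by apply: connect_trans (cr _ x) _; rewrite sym.
Qed.

Lemma QEC_max (R : realType) (X : sgraph) : (2 <= #|X|)%N ->
  QEC_set X (QEC R X) /\ ubound (QEC_set X) (QEC R X).
Proof.
move=> X2; apply: (@xgetPex _ 0 (QEC_set X `&` ubound (QEC_set X))).
have innerE m (f g : 'cV[R]_m) : inner f g = \sum_i f i 0 * g i 0.
  by rewrite /inner mxE; apply: eq_bigr => i _; rewrite mxE.
have contsum m (F : 'I_m -> 'rV[R]_#|X| -> R) :
    (forall i, continuous (F i)) -> continuous (fun u => \sum_i F i u).
  by move=> cF; apply: continuous_big => // ; exact: add_continuous.
have contu (i : 'I_#|X|) : continuous (fun u : 'rV[R]_#|X| => u 0 i).
  exact: coord_continuous.
have contM (f g : 'rV[R]_#|X| -> R) : continuous f -> continuous g ->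
    continuous (fun u => f u * g u).
  by move=> cf cg u; exact: continuousM (cf u) (cg u).
pose q (u : 'rV[R]_#|X|) := inner u^T (dist_mx R X *m u^T).
pose A := [set u : 'rV[R]_#|X| |
  inner u^T u^T = 1 /\ inner (const_mx 1) u^T = 0].
have AE : A =
    [set u | \sum_i u 0 i * u 0 i = 1] `&` [set u | \sum_i u 0 i = 0].
  have nE (u : 'rV[R]_#|X|) : inner u^T u^T = \sum_i u 0 i * u 0 i.
    by rewrite innerE; apply: eq_bigr => i _; rewrite !mxE.
  have sE (u : 'rV[R]_#|X|) : inner (const_mx 1) u^T = \sum_i u 0 i.
    by rewrite innerE; apply: eq_bigr => i _; rewrite !mxE mul1r.
  by apply/seteqP; split=> u; rewrite /A /= nE sE.
have cq : continuous q.
  have -> : q = fun u => \sum_i u 0 i * \sum_j dist_mx R X i j * u 0 j.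
    apply/funext => u; rewrite /q innerE; apply: eq_bigr => i _.
    by rewrite !mxE; congr (_ * _); apply: eq_bigr => j _; rewrite !mxE.
  apply: (contsum) => i; apply: (contM) => //; apply: (contsum) => j.
  by apply: (contM) => //; exact: cst_continuous.
have cA : compact A.
  rewrite AE; apply: bounded_closed_compact.
    exists 1; split=> // M M1 u [u1 _].
    apply: le_trans (ltW M1).
    have : mx_norm u <= 1.
      rewrite mx_normrE; apply/bigmax_leP; split=> // -[a i] _ /=.
      rewrite ord1 -(@ler_sqr _ `|u 0 i| 1) ?nnegrE// expr1n.
      rewrite real_normK ?num_real// -u1 (bigD1 i)//= -expr2 lerDl.
      rewrite sumr_ge0// => j _.
      by rewrite -expr2 sqr_ge0.
    by [].
  have clo (f : 'rV[R]_#|X| -> R) (c : R) :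
      continuous f -> closed [set u | f u = c].
    move=> /continuous_closedP cf.
    exact: (cf [set x | x = c] (@closed_eq R c)).
  apply: closedI; apply: (clo); apply: (contsum) => // i.
  exact: (contM).
have A0 : A !=set0.
  pose i0 : 'I_#|X| := Ordinal (ltnW X2); pose i1 : 'I_#|X| := Ordinal X2.
  pose s : R := (Num.sqrt 2)^-1.
  have i01 : (i1 == i0) = false by [].
  have z i : i != i0 -> i != i1 ->
    (if i == i0 then s else if i == i1 then - s else 0) = 0.
    by move=> /negbTE -> /negbTE ->.
  exists (\row_i (if i == i0 then s else if i == i1 then - s else 0)).
  rewrite AE /= !(bigD1 (P := predT) i0)//= !(bigD1 (P := fun i => i != i0) i1)//=.
  rewrite !big1 => [|i /andP[a b]|i /andP[a b]]; rewrite !mxE ?z ?mul0r//.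
  rewrite !eqxx i01 !addr0 subrr mulrNN; split=> //.
  by rewrite -expr2 /s exprVn sqr_sqrtr// -mulr2n -[_ *+ 2]mulr_natr mulVf.
have [c cA1 cmax] := EVT_max_rV A0 cA (continuous_subspaceT cq).
rewrite inE in cA1; exists (q c); split; first by exists c^T.
move=> _ [f fA <-]; have := cmax f^T; rewrite inE /q trmxK; apply.
by rewrite /A /= trmxK.
Qed.

Lemma min_ev_min (R : realType) (k : nat) (X : sgraph) :
  (1 <= #|X|)%N -> regular_graph k X ->
  ev (adj_mx R X) (min_ev (adj_mx R X)) /\
  lbound (ev (adj_mx R X)) (min_ev (adj_mx R X)).
Proof.
move=> X1 Xk; set S := ev _.
apply: (@xgetPex _ 0 (S `&` lbound S)).
have minroot n (p : {poly R}) a : (size p <= n)%N -> p != 0 -> root p a ->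
    exists2 b, root p b & forall c, root p c -> b <= c.
  elim: n p a => [p a|n ih p a pn p0 /factor_theorem[q pE]].
    by rewrite leqn0 size_poly_eq0 => ->.
  have q0 : q != 0 by apply: contra p0; rewrite pE => /eqP ->; rewrite mul0r.
  have rE c : root p c = root q c || (c == a) by rewrite pE rootM root_XsubC.
  have [[b qb]|nq] := pselect (exists b, root q b).
    have qn : (size q <= n)%N.
      by move: pn; rewrite pE size_Mmonic ?monicXsubC// size_XsubC addn2.
    have [m qm mle] := ih q b qn q0 qb.
    exists (Num.min m a) => [|c]; rewrite rE.
      by rewrite /Num.min; case: ifP; rewrite ?qm ?eqxx ?orbT.
    by case/orP => [/mle|/eqP ->]; rewrite ge_min ?lexx ?orbT// => ->.
  exists a => [|c]; rewrite rE ?eqxx ?orbT// => /orP[qc|/eqP -> //].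
  by case: nq; exists c.
have chE c : S c = root (char_poly (adj_mx R X)) c.
  by rewrite /S /ev /= eigenvalue_root_char.
have ek : S k%:R.
  apply/eigenvalueP; exists (const_mx 1); last first.
    apply/eqP => /matrixP/(_ 0 (Ordinal X1)); rewrite !mxE => /eqP.
    by rewrite oner_eq0.
  apply/matrixP => i j; rewrite !mxE mulr1.
  rewrite -(Xk (enum_val j)) cardsE -sum1_card natr_sum [RHS]big_mkcond.
  rewrite [RHS](reindex (fun i : 'I_#|X| => enum_val i)) /=; last first.
    exact: onW_bij (enum_val_bij _).
  apply: eq_bigr => h _; rewrite !mxE mul1r adj_sym -topredE /=.
  by case: adj.
rewrite chE in ek.
have [b rb bmin] := minroot _ _ _ (leqnn _) (monic_neq0 (char_poly_monic _)) ek.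
by exists b; split=> [|c]; rewrite chE// => /bmin.
Qed.

(* Main.v *)
(* For f of sum 0 on the vertices of the corona, let f_x be the restriction of f
   to the copy of H at x, and let g x be the sum of f over x and its copy.  Since
   the distance between two vertices is the distance of their base points in G
   plus the number of them lying in copies of H, except inside a single copy,
     <f, D f> = <g, D_G g> - \sum_x <f_x, (2 + A_H) f_x>.
   When QEC(G) <= 0 and min ev(A_H) >= -2, both contributions are nonpositive.
   The value 0 is attained by a maximiser of G extended by 0 when QEC(G) = 0, and
   when min ev(A_H) = -2 by a (-2)-eigenvector placed in one copy of H and
   balanced at its base point, so that g = 0. *)
Require Import Defs.
From mathcomp Require Import all_boot all_order all_algebra.
From mathcomp Require Import all_classical all_reals all_analysis.
From mathcomp Require Import zify ring lra.

Set Implicit Arguments.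
Unset Strict Implicit.
Unset Printing Implicit Defensive.

Import Order.TTheory GRing.Theory Num.Theory.
Import numFieldNormedType.Exports.
Local Open Scope ring_scope.

(** * Nonnegative quadratic forms and the least eigenvalue *)

Lemma mulmx_tr_ge0 (R : realDomainType) n (u : 'rV[R]_n) : 0 <= (u *m u^T) 0 0.
Proof. by rewrite mxE sumr_ge0// => i _; rewrite mxE -expr2 sqr_ge0. Qed.

Lemma mulmx_tr_eq0 (R : realDomainType) n (u : 'rV[R]_n) :
  ((u *m u^T) 0 0 == 0) = (u == 0).
Proof.
apply/eqP/eqP => [|->]; last by rewrite mul0mx mxE.
move=> /eqP; rewrite mxE psumr_eq0 => [|i _]; last by rewrite mxE -expr2 sqr_ge0.
move=> /allP u0; apply/rowP => i; rewrite mxE.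
have /= := u0 i (mem_index_enum i).
by rewrite mxE -expr2 sqrf_eq0 => /eqP.
Qed.

(** A zero of a nonnegative form minimises it, so the gradient 2vB vanishes there. *)
Lemma psd_form_eq0 (R : realFieldType) n (B : 'M[R]_n) (v : 'rV[R]_n) :
    B^T = B -> (forall w : 'rV[R]_n, 0 <= (w *m B *m w^T) 0 0) ->
  (v *m B *m v^T) 0 0 = 0 -> v *m B = 0.
Proof.
move=> Bsym Bpos v0; apply/eqP; rewrite -mulmx_tr_eq0.
set z := v *m B; set c : R := (z *m z^T) 0 0.
pose e : R := (z *m B *m z^T) 0 0.
have e0 : 0 <= e := Bpos z.
have c0 : 0 <= c := mulmx_tr_ge0 z.
rewrite -/z in v0.
have zv : (z *m B *m v^T) 0 0 = c by rewrite -mulmxA -{1}Bsym -trmx_mul.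
have addE (M N : 'M[R]_1) : (M + N) 0 0 = M 0 0 + N 0 0 by rewrite mxE.
have scaleE a (M : 'M[R]_1) : (a *: M) 0 0 = a * M 0 0 by rewrite mxE.
have expand t : ((v + t *: z) *m B *m (v + t *: z)^T) 0 0
    = 2 * t * c + t ^+ 2 * e.
  rewrite linearD /= linearZ /= !mulmxDl !mulmxDr -!scalemxAl -!scalemxAr -/z.
  rewrite !addE !scaleE zv v0 -/c -/e; ring.
(* The parameter chosen below is t = -c/(e+1) instead of the optimal -c/e, because e may be 0. *)
have e1 : 0 < e + 1 by lra.
(* Perturbing v by t z changes the form by 2 t |z|^2 + O(t^2), which is negative
   for small t < 0 unless z = 0. *)
have := Bpos (v + (- c / (e + 1)) *: z); rewrite expand.
have -> : 2 * (- c / (e + 1)) * c + (- c / (e + 1)) ^+ 2 * e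
  = - (c ^+ 2 * (e + 2) / (e + 1) ^+ 2) by field; rewrite gt_eqF.
rewrite oppr_ge0 pmulr_lle0 ?invr_gt0 ?exprn_gt0// pmulr_lle0; last lra.
by move=> c2; rewrite -sqrf_eq0 eq_le c2 sqr_ge0.
Qed.

(** Rayleigh's principle without diagonalisation: by compactness the form has a minimum on the unit
    sphere, and this minimum is itself an eigenvalue, hence at least [m]. *)
Lemma form_ge_lbound_ev (R : realType) n (A : 'M[R]_n) (m : R) (u : 'rV[R]_n) :
    A^T = A -> lbound (ev A) m ->
  m * (u *m u^T) 0 0 <= (u *m A *m u^T) 0 0.
Proof.
move=> Asym lbm.
have [->|u0] := eqVneq u 0; first by rewrite !mul0mx !mxE mulr0.
have cM (B : 'M[R]_n) : continuous (fun w : 'rV[R]_n => (w *m B *m w^T) 0 0).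
  have csum m' (F : 'I_m' -> 'rV[R]_n -> R) :
      (forall i, continuous (F i)) -> continuous (fun w => \sum_i F i w).
    by move=> cF; apply: continuous_big => //; exact: add_continuous.
  have -> : (fun w : 'rV[R]_n => (w *m B *m w^T) 0 0) =
      fun w => \sum_i (\sum_j w 0 j * B j i) * w 0 i.
    by apply/funext => w; rewrite mxE; apply: eq_bigr => i _; rewrite !mxE.
  apply: (csum) => i w; apply: continuousM; last exact: coord_continuous.
  apply: csum => j {}w.
  by apply: continuousM; [exact: coord_continuous|exact: cst_continuous].
(* Writing the squared norm as the form of [1%:M] lets [cM] give the closedness of [S] as well. *)
pose S := [set w : 'rV[R]_n | (w *m 1%:M *m w^T) 0 0 = 1]%classic.
have normalise w : w != 0 -> exists2 k : R, k != 0 & S (k *: w).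
  move=> w0; have W : 0 < (w *m w^T) 0 0.
    by rewrite lt_def mulmx_tr_eq0 w0 mulmx_tr_ge0.
  exists (Num.sqrt ((w *m w^T) 0 0))^-1; first by rewrite invr_eq0 sqrtr_eq0 -ltNge.
  rewrite /S /= mulmx1 linearZ /= -scalemxAl -scalemxAr scalerA mxE -expr2 exprVn.
  by rewrite sqr_sqrtr ?ltW// mulVf// gt_eqF.
have S0 : (S !=set0)%classic by have [k _ Sk] := normalise _ u0; exists (k *: u).
have cS : compact S.
  apply: bounded_closed_compact; last first.
    move/continuous_closedP: (cM 1%:M) => c1.
    exact: (c1 [set x | x = 1]%classic (@closed_eq R 1)).
  exists 1; split=> // M M1 w; rewrite /S /= mulmx1 mxE => w1.
  apply: le_trans (ltW M1).
  suff : mx_norm w <= 1 by [].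
  rewrite mx_normrE; apply/bigmax_leP; split=> // -[a i] _ /=.
  rewrite ord1 -(@ler_sqr _ `|w 0 i| 1) ?nnegrE// expr1n.
  rewrite real_normK ?num_real// -w1 (bigD1 i)//= mxE -expr2 lerDl.
  by rewrite sumr_ge0// => j _; rewrite mxE -expr2 sqr_ge0.
(* A minimiser of the form on the unit sphere is an eigenvector of A whose
   eigenvalue is the minimum l. *)
have [v Sv vmin] := EVT_min_rV S0 cS (continuous_subspaceT (cM A)).
rewrite inE /S /= mulmx1 in Sv.
set l : R := (v *m A *m v^T) 0 0 in vmin.
have formE (w : 'rV[R]_n) : (w *m (A - l%:M) *m w^T) 0 0 =
    (w *m A *m w^T) 0 0 - l * (w *m w^T) 0 0.
  by rewrite mulmxBr mulmxBl mul_mx_scalar -scalemxAl !mxE.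
(* Everything is homogeneous of degree 2, so minimality on the sphere extends to all rows by
   rescaling. *)
have pos (w : 'rV[R]_n) : 0 <= (w *m (A - l%:M) *m w^T) 0 0.
  have [->|w0] := eqVneq w 0; first by rewrite !mul0mx mxE.
  have [k k0 Sk] := normalise _ w0.
  have := vmin (k *: w); rewrite inE => /(_ Sk); rewrite -subr_ge0.
  move: Sk; rewrite /S /= mulmx1 => k1.
  rewrite -[X in _ - X]mulr1 -[X in _ - _ * X]k1 -formE.
  rewrite linearZ /= -!scalemxAl -!scalemxAr scalerA mxE -expr2.
  by rewrite pmulr_rge0// exprn_even_gt0.
have vl : v *m (A - l%:M) = 0.
  apply: psd_form_eq0 => //; first by rewrite linearB /= Asym tr_scalar_mx.
  by rewrite formE Sv mulr1 subrr.
have /lbm ml : ev A l.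
  apply/eigenvalueP; exists v.
    by apply/eqP; rewrite -subr_eq0 -mul_mx_scalar -mulmxBr vl.
  apply: contra_eq_neq Sv => ->; rewrite mul0mx mxE eq_sym; exact: oner_neq0.
apply: (@le_trans _ _ (l * (u *m u^T) 0 0)).
  by rewrite ler_wpM2r// mulmx_tr_ge0.
by rewrite -subr_ge0 -formE.
Qed.
(* A function that is 1-Lipschitz along edges and can always be decreased by 1
   along some edge until v is reached is the distance to v. *)
Lemma dist_potential (X : sgraph) (v : X) (phi : X -> nat) :
    phi v = 0%N ->
    (forall x y : X, adj x y -> (phi x <= (phi y).+1)%N) ->
    (forall x : X, phi x = 0%N -> x = v) ->
    (forall (x : X) n, phi x = n.+1 -> exists2 y : X, adj x y & phi y = n) ->
  forall x, dist x v = phi x.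
Proof.
move=> phiv lip phi0 step x.
have descent n : forall y, phi y = n ->
    exists p : seq X, [/\ path (@adj X) y p, last y p = v & size p = n].
  elim: n => [|n ih] y yn; first by exists [::]; split=> //=; exact: phi0.
  have [z yz /ih[p [pP pv <-]]] := step _ _ yn.
  by exists (z :: p); split=> //=; rewrite yz.
have lower p y : path (@adj X) y p -> (phi y <= phi (last y p) + size p)%N.
  elim: p y => [|z p ih] y /=; first by rewrite addn0.
  move=> /andP[/lip yz /ih zp]; lia.
have [p [pP pv ps]] := descent _ _ (erefl (phi x)).
have xv : connect (@adj X) x v by apply/connectP; exists p.
have [[q qP [qv qs]] least] := distP xv.
apply/eqP; rewrite eqn_leq -{1}ps least//= -qs.
by have := lower _ _ qP; rewrite qv phiv.
Qed.

(** * Distances in a connected graph *)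

Section ConnectedDist.
Variable X : sgraph.
Hypothesis cX : connected_graph X.

Lemma dist_self (x : X) : dist x x = 0%N.
Proof.
have [_ least] := distP (cX x x).
by apply/eqP; rewrite -leqn0 (least [::]).
Qed.

Lemma dist_eq0 (x y : X) : dist x y = 0%N -> x = y.
Proof.
have [[p _ [<- <-]] _] := distP (cX x y).
by move/size0nil => ->.
Qed.

Lemma dist_adj_le (x y z : X) : adj x y -> (dist x z <= (dist y z).+1)%N.
Proof.
move=> xy; have [[p pP [pz <-]] _] := distP (cX y z).
have [_ least] := distP (cX x z).
by apply: (least (y :: p)); rewrite //= xy.
Qed.

(** The second vertex of a shortest walk works: the rest of the walk bounds its distance above,
    [dist_adj_le] bounds it below. *)
Lemma dist_step (x z : X) n :
  dist x z = n.+1 -> exists2 y : X, adj x y & dist y z = n.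
Proof.
move=> xz; have [[[|y p] /=]] := distP (cX x z).
  by move=> _ [_ xz0]; rewrite -xz0 in xz.
move=> /andP[xy pP] [pz ps] _.
exists y => //; have [_ /(_ p pP pz)] := distP (cX y z).
have := dist_adj_le z xy; lia.
Qed.

End ConnectedDist.

(** * Distances in the corona *)

Section CoronaDist.
Variables G H : sgraph.
Hypothesis cG : connected_graph G.

Lemma dist_corona_l (u : corona G H) (y : G) :
  dist u (inl y : corona G H) =
  match u with inl x => dist x y | inr (x, _) => (dist x y).+1 end.
Proof.
pose phi (u : corona G H) : nat :=
  match u with inl x => dist x y | inr (x, _) => (dist x y).+1 end.
apply: (@dist_potential _ (inl y : corona G H) phi) => /=.
- exact: dist_self.
- case=> [x|[x h]] [x'|[x' h']] //=; first exact: dist_adj_le.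
  + by move=> /eqP ->; lia.
  + by move=> /eqP ->; lia.
  + by move=> /andP[/eqP -> _]; lia.
- by case=> [x|[x h]] //= /(dist_eq0 cG) ->.
- case=> [x|[x h]] n /= => [/(dist_step cG)[z xz zn]|[<-]].
    by exists (inl z).
  by exists (inl x) => //=; rewrite eqxx.
Qed.

(** Inside one copy the base point is a common neighbour, so distances never exceed 2; a walk
    between different copies passes through both base points. *)
Lemma dist_corona_r (u : corona G H) (y : G) (k : H) :
  dist u (inr (y, k) : corona G H) =
  match u with
  | inl x => (dist x y).+1
  | inr (x, h) =>
      if x == y then if h == k then 0%N else if adj h k then 1%N else 2
      else (dist x y).+2
  end.
Proof.
pose phi (u : corona G H) : nat := match u with
  | inl x => (dist x y).+1
  | inr (x, h) =>
      if x == y then if h == k then 0%N else if adj h k then 1%N else 2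
      else (dist x y).+2
  end.
apply: (@dist_potential _ (inr (y, k) : corona G H) phi) => /=.
- by rewrite !eqxx.
- case=> [x|[x h]] [x'|[x' h']] //=; first by rewrite ltnS; exact: dist_adj_le.
  + move=> /eqP <-; case: eqP => [->|]; last lia.
    by rewrite dist_self.
  + move=> /eqP <-; case: eqP => [->|]; last lia.
    by rewrite dist_self//; case: ifP => //; case: ifP.
  + move=> /andP[/eqP <- hh']; case: eqP => // _.
    have [_|_] := eqVneq h k; first by [].
    have [h'k|_] := eqVneq h' k; first by rewrite -h'k hh'.
    by case: ifP => //; case: ifP.
- case=> [x|[x h]] //=; case: eqP => // ->.
  by case: eqP => [->|_] //; case: ifP.
- case=> [x|[x h]] n /=.
    (* At the base point of the target copy the next vertex is the target; elsewhere the walk moves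
       inside [G]. *)
    move=> [<-]; case xy : (dist x y) => [|m].
      by exists (inr (x, k)); rewrite /= ?eqxx ?(dist_eq0 cG xy) ?eqxx.
    by have [z xz zm] := dist_step cG xy; exists (inl z); rewrite //= zm.
  case: eqP => [->|xy].
    case: eqP => // _; case: ifP => hk [<-].
      by exists (inr (y, k)); rewrite /= !eqxx.
    (* Distinct nonadjacent vertices of one copy are joined through their base point. *)
    by exists (inl y); rewrite /= ?eqxx ?dist_self.
  by move=> [<-]; exists (inl x); rewrite //= eqxx.
Qed.

End CoronaDist.

(** * Functions on vertices as column vectors *)

Definition vec (R : realType) (X : sgraph) (F : X -> R) : 'cV[R]_#|X| :=
  \col_i F (enum_val i).

Section VertexVectors.
Variables (R : realType) (X : sgraph).
Implicit Types F E : X -> R.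

Lemma sum_enum_val F : \sum_(i < #|X|) F (enum_val i) = \sum_x F x.
Proof.
rewrite [RHS](reindex (fun i : 'I_#|X| => enum_val i)) //.
exact: onW_bij (enum_val_bij _).
Qed.

Lemma vec_surj (f : 'cV[R]_#|X|) : exists F, f = vec F.
Proof.
exists (fun x => f (enum_rank x) 0).
by apply/colP => i; rewrite mxE enum_valK.
Qed.

Lemma inner_vec F E : inner (vec F) (vec E) = \sum_x F x * E x.
Proof.
by rewrite /inner mxE -sum_enum_val; apply: eq_bigr => i _; rewrite !mxE.
Qed.

Lemma inner1_vec F : inner (const_mx 1) (vec F) = \sum_x F x.
Proof.
have -> : const_mx 1 = vec (fun _ : X => 1 : R) by apply/colP => i; rewrite !mxE.
by rewrite inner_vec; apply: eq_bigr => x _; rewrite mul1r.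
Qed.

Lemma dist_mx_vec F :
  dist_mx R X *m vec F = vec (fun x => \sum_y (dist x y)%:R * F y).
Proof.
apply/colP => i; rewrite !mxE -sum_enum_val.
by apply: eq_bigr => j _; rewrite !mxE.
Qed.

Lemma adj_mx_vec F :
  adj_mx R X *m vec F = vec (fun x => \sum_y (adj x y)%:R * F y).
Proof.
apply/colP => i; rewrite !mxE -sum_enum_val.
by apply: eq_bigr => j _; rewrite !mxE.
Qed.

Lemma vec_eq0 F : vec F = 0 -> forall x, F x = 0.
Proof.
by move=> F0 x; have /colP/(_ (enum_rank x)) := F0; rewrite !mxE enum_rankK.
Qed.

Lemma adj_mx_tr : (adj_mx R X)^T = adj_mx R X.
Proof. by apply/matrixP => i j; rewrite !mxE adj_sym. Qed.

End VertexVectors.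

(** * Rayleigh quotients and QEC *)

Section InnerProduct.
Variable R : realType.

Lemma innerZl n a (f g : 'cV[R]_n) : inner (a *: f) g = a * inner f g.
Proof. by rewrite /inner linearZ /= -scalemxAl mxE. Qed.

Lemma innerZr n a (f g : 'cV[R]_n) : inner f (a *: g) = a * inner f g.
Proof. by rewrite /inner -scalemxAr mxE. Qed.

Lemma inner0l n (g : 'cV[R]_n) : inner 0 g = 0.
Proof. by rewrite /inner trmx0 mul0mx mxE. Qed.

Lemma inner_gt0 n (f : 'cV[R]_n) : f != 0 -> 0 < inner f f.
Proof.
move=> f0; have := mulmx_tr_ge0 f^T; rewrite le_eqVlt eq_sym mulmx_tr_eq0 trmxK.
by rewrite trmx_eq0 (negbTE f0).
Qed.

Lemma inner_ge_lbound_ev n (A : 'M[R]_n) (m : R) (f : 'cV[R]_n) :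
  A^T = A -> lbound (ev A) m -> m * inner f f <= inner f (A *m f).
Proof.
by move=> At /(form_ge_lbound_ev f^T At); rewrite trmxK /inner mulmxA.
Qed.

Lemma QEC_set_normalise (X : sgraph) (f : 'cV[R]_#|X|) :
    f != 0 -> inner (const_mx 1) f = 0 ->
  QEC_set X (inner f (dist_mx R X *m f) / inner f f).
Proof.
move=> /inner_gt0 f0 f1; pose k := (Num.sqrt (inner f f))^-1.
have kk : k * k = (inner f f)^-1.
  by rewrite -expr2 exprVn sqr_sqrtr ?ltW.
exists (k *: f).
  split; last by rewrite innerZr f1 mulr0.
  by rewrite innerZl innerZr mulrA kk mulVf// gt_eqF.
by rewrite -scalemxAr innerZl innerZr mulrA kk mulrC.
Qed.

Lemma inner_dist_mx_le_QEC (X : sgraph) (f : 'cV[R]_#|X|) :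
    (2 <= #|X|)%N -> inner (const_mx 1) f = 0 ->
  inner f (dist_mx R X *m f) <= QEC R X * inner f f.
Proof.
move=> X2 f1; have [->|f0] := eqVneq f 0; first by rewrite !inner0l mulr0.
have [_ /(_ _ (QEC_set_normalise f0 f1))] := QEC_max R X2.
by rewrite ler_pdivrMr// inner_gt0.
Qed.

End InnerProduct.

(** * The distance form of the corona *)

Section CoronaForm.
Variables (R : realType) (G H : sgraph).
Hypothesis cG : connected_graph G.

Lemma sum_corona (E : corona G H -> R) :
  \sum_u E u = \sum_x (E (inl x) + \sum_h E (inr (x, h))).
Proof.
rewrite big_sumType big_split /=; congr (_ + _).
by rewrite pair_big /=; apply: eq_bigr => -[].
Qed.

(** Base distance plus 2 overestimates only inside a single copy, by the entries of 2I + A_H; the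
    constant -2 in [gamma3] comes from here. *)
Lemma dist_corona_rr (x y : G) (h k : H) :
  (dist (inr (x, h) : corona G H) (inr (y, k) : corona G H))%:R =
  (dist x y)%:R + 2 - (x == y)%:R * (2 * (h == k)%:R + (adj h k)%:R) :> R.
Proof.
rewrite dist_corona_r//; case: eqP => [->|_]; last by rewrite -addn2 natrD /=; ring.
rewrite dist_self//; case: eqP => [->|_]; first by rewrite adj_irr /=; ring.
by case: adj => /=; ring.
Qed.

Variable F : corona G H -> R.
Hypothesis F_sum : \sum_u F u = 0.

(** [g] collapses each copy onto its base point, [P] is D_G applied to [g], and [N x] is 2I + A_H
    applied to [b x]. *)
Let b x (h : H) : R := F (inr (x, h)).
Let g x : R := F (inl x) + \sum_h b x h.
Let s : R := \sum_x \sum_h b x h.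
Let P x : R := \sum_y (dist x y)%:R * g y.
Let N x h : R := 2 * b x h + \sum_k (adj h k)%:R * b x k.

Lemma sum_g : \sum_x g x = 0.
Proof. by rewrite -[RHS]F_sum sum_corona. Qed.

Lemma dist_corona_mul_l x :
  \sum_u (dist (inl x : corona G H) u)%:R * F u = P x + s.
Proof.
rewrite sum_corona /P /s -big_split; apply: eq_bigr => y _ /=.
rewrite dist_corona_l// mulrDr mulr_sumr -addrA -big_split; congr (_ + _).
by apply: eq_bigr => h _; rewrite dist_corona_r// -addn1 natrD /b /=; ring.
Qed.

(** Compared with the row of [inl x], every distance grows by 1, which contributes the total sum 0,
    apart from the correction [N] inside the copy at [x]. *)
Lemma dist_corona_mul_r x h :
  \sum_u (dist (inr (x, h) : corona G H) u)%:R * F u = P x + s - N x h.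
Proof.
(* The zero total is subtracted as the sum of [g], and [NE] spreads [N] over all base points, so
   that both sides compare term by term. *)
rewrite sum_corona -[LHS]subr0 -[X in _ - X = _]sum_g.
have NE : N x h =
    \sum_y (x == y)%:R * \sum_k (2 * (h == k)%:R + (adj h k)%:R) * b y k.
  rewrite (bigD1 x)//= [X in _ + X]big1 ?addr0 => [|y /negbTE]; last first.
    by rewrite eq_sym => ->; rewrite mul0r.
  rewrite eqxx mul1r; under eq_bigr do rewrite mulrDl.
  rewrite big_split /=; congr (_ + _); rewrite (bigD1 h)//= [X in _ + X]big1 ?addr0.
    by rewrite eqxx mulr1.
  by move=> k /negbTE; rewrite eq_sym => ->; rewrite mulr0 mul0r.
rewrite NE /P /s -sumrN -big_split -sumrN -!big_split; apply: eq_bigr => y _ /=.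
rewrite dist_corona_l//.
under eq_bigr do rewrite dist_corona_rr.
have -> : \sum_k ((dist x y)%:R + 2 -
      (x == y)%:R * (2 * (h == k)%:R + (adj h k)%:R)) * F (inr (y, k)) =
    ((dist x y)%:R + 2) * \sum_k b y k -
    (x == y)%:R * \sum_k (2 * (h == k)%:R + (adj h k)%:R) * b y k.
  rewrite !mulr_sumr -sumrN -big_split; apply: eq_bigr => k _ /=.
  by rewrite /b; ring.
by rewrite /g -addn1 natrD; ring.
Qed.

(** A base point and its copy share the value [P x + s], so pairing it with [F] only sees [g]; the
    constant [s] drops out since [g] has sum 0, and the corrections [N] remain. *)
Lemma corona_form :
  inner (vec F) (dist_mx R (corona G H) *m vec F) =
  inner (vec g) (dist_mx R G *m vec g) -
  \sum_x (2 * inner (vec (b x)) (vec (b x)) +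
          inner (vec (b x)) (adj_mx R H *m vec (b x))).
Proof.
rewrite !dist_mx_vec !inner_vec sum_corona.
have gs : \sum_x g x * s = 0 by rewrite -mulr_suml sum_g mul0r.
rewrite -[RHS]addr0 -[X in _ = _ + X]gs -sumrN -!big_split.
apply: eq_bigr => x _ /=; rewrite adj_mx_vec !inner_vec dist_corona_mul_l.
have -> : \sum_h F (inr (x, h)) *
      (\sum_u (dist (inr (x, h) : corona G H) u)%:R * F u) =
    (\sum_h b x h) * (P x + s) - (2 * (\sum_h b x h * b x h) +
      \sum_h b x h * \sum_k (adj h k)%:R * b x k).
  under eq_bigr do rewrite dist_corona_mul_r.
  move: (P x + s) => t.
  rewrite mulr_suml mulr_sumr -big_split -sumrN -big_split.
  by apply: eq_bigr => h _ /=; rewrite /N -/(b x h); ring.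
by rewrite -/(P x) /g; ring.
Qed.

End CoronaForm.

Theorem theorem5 (R : realType) (G H : sgraph) (kappa : nat)
    (G_connected : connected_graph G) (G_card : (2 <= #|G|)%N)
    (H_card : (1 <= #|H|)%N) (H_regular : regular_graph kappa H) :
  let gamma3 : R := - 2 - min_ev (adj_mx R H) in
  (QEC R G = 0 /\ gamma3 <= 0) \/ (QEC R G <= 0 /\ gamma3 = 0) ->
  QEC R (corona G H) = 0.
Proof.
move=> gamma3 cases.
have [m_ev m_lb] := min_ev_min R H_card H_regular.
set m := min_ev _ in m_ev m_lb.
have [QG m2] : QEC R G <= 0 /\ - 2 <= m.
  by case: cases; rewrite /gamma3 -/m => -[Q ?]; split; rewrite ?Q//; lra.
have corona_card : (2 <= #|corona G H|)%N.
  by rewrite card_sum (leq_trans G_card)// leq_addr.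
have upper : ubound (QEC_set (corona G H)) (0 : R).
  move=> _ [f [_ f_sum] <-]; have [F fE] := vec_surj f.
  move: f_sum; rewrite fE inner1_vec => F_sum.
  rewrite corona_form// subr_le0; apply: (@le_trans _ _ 0).
    apply: le_trans (inner_dist_mx_le_QEC G_card _) _.
      by rewrite inner1_vec (sum_g F_sum).
    by rewrite mulr_le0_ge0// inner_vec sumr_ge0// => x _; rewrite -expr2 sqr_ge0.
  (* Each copy contributes at least (2 + m) times the squared norm of [w], and 2 + m is
     nonnegative. *)
  apply: sumr_ge0 => x _; set w := vec _.
  have := inner_ge_lbound_ev w (adj_mx_tr R H) m_lb.
  have : 0 <= inner w w by have := mulmx_tr_ge0 w^T; rewrite trmxK.
  move=> w0 mw; have : - 2 * inner w w <= m * inner w w by rewrite ler_wpM2r.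
  lra.
have attained : QEC_set (corona G H) (0 : R).
  case: cases => [[QG0 _]|[_ gamma0]].
    have [[f [f1 f_sum] fQ] _] := QEC_max R G_card; rewrite QG0 in fQ.
    have [g gE] := vec_surj f; rewrite gE inner_vec in f1.
    rewrite gE inner1_vec in f_sum; rewrite gE in fQ.
    pose F (u : corona G H) : R := if u is inl x then g x else 0.
    have F_sum : \sum_u F u = 0.
      by rewrite sum_corona -[RHS]f_sum; apply: eq_bigr => x _; rewrite big1// addr0.
    exists (vec F).
      split; last by rewrite inner1_vec.
      rewrite inner_vec sum_corona -[RHS]f1; apply: eq_bigr => x _.
      by rewrite big1 ?addr0// => h _; rewrite mul0r.
    have gF : (fun x => F (inl x) + \sum_h F (inr (x, h))) = g.
      by apply/funext => x; rewrite /F big1// addr0.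
    have copies0 x : vec (fun h => F (inr (x, h))) = 0.
      by apply/colP => i; rewrite !mxE.
    rewrite corona_form// gF fQ sub0r big1 ?oppr0// => x _.
    by rewrite copies0 !inner0l mulr0 addr0.
  have m_eq : m = - 2 by move: gamma0; rewrite /gamma3 -/m; lra.
  have [v vA v0] := eigenvalueP m_ev.
  (* [eigenvalue] provides a left eigenvector; the symmetry of the matrix turns it into a column. *)
  have {}vA : adj_mx R H *m v^T = - 2 *: v^T.
    by rewrite -{1}adj_mx_tr -trmx_mul vA m_eq linearZ.
  have [w wE] := vec_surj v^T; rewrite wE in vA.
  pose x0 : G := enum_val (Ordinal (ltnW G_card)).
  pose F (u : corona G H) : R := match u with
    | inl x => - ((x == x0)%:R * \sum_h w h)
    | inr (x, h) => (x == x0)%:R * w h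
    end.
  have gF x : F (inl x) + \sum_h F (inr (x, h)) = 0.
    by rewrite /F -mulr_sumr addNr.
  have F_sum : \sum_u F u = 0 by rewrite sum_corona big1.
  have F0 : vec F != 0.
    apply: contra v0 => /eqP/vec_eq0 F0; rewrite -trmx_eq0 wE; apply/eqP/colP => i.
    have := F0 (inr (x0, enum_val i)).
    by rewrite /F eqxx mul1r !mxE.
  have := QEC_set_normalise F0; rewrite inner1_vec => /(_ F_sum).
  (* Both parts of the form vanish, so dividing by the squared norm still gives 0. *)
  rewrite corona_form// [X in _ - X]big1 => [|x _].
    have -> : vec (fun x => F (inl x) + \sum_h F (inr (x, h))) = 0.
      by apply/colP => i; rewrite !mxE gF.
    by rewrite inner0l subr0 mul0r.
  have -> : vec (fun h => F (inr (x, h))) = (x == x0)%:R *: vec w.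
    by apply/colP => i; rewrite !mxE.
  by rewrite -scalemxAr vA !innerZl !innerZr; ring.
(* [QEC] is a genuine maximum here, squeezed between the attained value 0 and the upper bound 0. *)
have [QEC_in QEC_ub] := QEC_max R corona_card.
by apply/eqP; rewrite eq_le upper// QEC_ub.
Qed.
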